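(* Let $G$ be a finite group with $G=NH$, where $N$ is a normal subgroup of $G$ and $H$ is a subgroup of $G$. Then $$sd(G)\ \ge\ \frac{1}{|\mathrm{L}(G)|^2}\sqrt{\ \sum_{\substack{(X,Y)\in\mathrm{L}(N)^2\\ (Z,T)\in\mathrm{L}(H)^2}}\chi(X,Y)\,\chi(Z,T)\ }.$$
   Context: All groups are finite. For a group $G$, $\mathrm{L}(G)$ is the set of all subgroups of $G$. For subgroups $X,Y$ of a group, $\chi(X,Y)=1$ if $XY=YX$ and $\chi(X,Y)=0$ otherwise. The subgroup commutativity degree of $G$ is $$sd(G)=\frac{|\{(X,Y)\in\mathrm{L}(G)^2\mid XY=YX\}|}{|\mathrm{L}(G)|^2}=\frac{1}{|\mathrm{L}(G)|^2}\sum_{(X,Y)\in\mathrm{L}(G)^2}\chi(X,Y).$$ *)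

(* Defs.v *)
From HB Require Import structures.
From mathcomp Require Import all_boot all_order all_algebra all_fingroup.

Set Implicit Arguments.
Unset Strict Implicit.
Unset Printing Implicit Defensive.

Import Order.TTheory GRing.Theory Num.Theory.
Local Open Scope ring_scope.

(* The product of the underlying sets X * Y is in general not a group. *)
Definition permutes (gT : finGroupType) (X Y : {group gT}) : bool :=
  ((X : {set gT}) * Y == (Y : {set gT}) * X)%g.

Definition chi (gT : finGroupType) (X Y : {group gT}) : nat :=
  if permutes X Y then 1%N else 0%N.

Definition subgroup_pairs (gT : finGroupType) (G : {group gT}) :
    {set {group gT} * {group gT}} :=
  setX (subgroups G) (subgroups G).

(* The subgroup commutativity degree, as an element of the field R. *)
Definition sd (R : numFieldType) (gT : finGroupType) (G : {group gT}) : R :=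
  #|[set p in subgroup_pairs G | permutes p.1 p.2]|%:R
    / #|subgroups G|%:R ^+ 2.

Lemma sd_sum (R : numFieldType) (gT : finGroupType) (G : {group gT}) :
  sd R G = (#|subgroups G|%:R ^+ 2)^-1
           * \sum_(p in subgroup_pairs G) (chi p.1 p.2)%:R.
Proof.
rewrite /sd mulrC; congr (_ * _).
rewrite -natr_sum -sum1_card; congr (_%:R).
rewrite [RHS](bigID (fun p => permutes p.1 p.2)) /= [X in (_ + X)%N]big1 ?addn0.
  apply: eq_big => [p|p]; first by rewrite inE.
  by rewrite inE /chi => /andP[_ ->].
by move=> p /andP[_ /negbTE]; rewrite /chi => ->.
Qed.

(* Main.v *)
(* Subgroups of N and of H are subgroups of G, so each of the two factors of the
   sum under the root is at most the number of permuting pairs of subgroups of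
   G, and the root is at most that number. *)

Require Import Defs.
From HB Require Import structures.
From mathcomp Require Import all_boot all_order all_algebra all_fingroup.

Set Implicit Arguments.
Unset Strict Implicit.
Unset Printing Implicit Defensive.

Import Order.TTheory GRing.Theory Num.Theory.
Local Open Scope ring_scope.

(** The pairs from [G] that are not pairs from [K] only add nonnegative terms. *)
Lemma sum_chi_subset (R : numFieldType) (gT : finGroupType) (G K : {group gT}) :
  K \subset G ->
  \sum_(p in subgroup_pairs K) (chi p.1 p.2)%:R
    <= \sum_(p in subgroup_pairs G) (chi p.1 p.2)%:R :> R.
Proof.
move=> sKG; rewrite [leRHS](big_setID (subgroup_pairs K)) /=.
have /setIidPr -> : subgroup_pairs K \subset subgroup_pairs G.
  by apply: setXS; apply/subsetP=> X; rewrite !inE => /subset_trans->.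
by rewrite lerDl sumr_ge0.
Qed.

Theorem corollary2p11 (R : rcfType) (gT : finGroupType) (G N H : {group gT})
    (nNG : (N <| G)%g) (sHG : H \subset G)
    (defG : ((N : {set gT}) * H)%g = G :> {set gT}) :
  (#|subgroups G|%:R ^+ 2)^-1
    * Num.sqrt (\sum_(q in setX (subgroup_pairs N) (subgroup_pairs H))
                   (chi q.1.1 q.1.2)%:R * (chi q.2.1 q.2.2)%:R)
  <= sd R G.
Proof.
rewrite sd_sum ler_wpM2l ?invr_ge0 ?sqr_ge0 //.
have sum_ge0 (K : {group gT}) :
    0 <= \sum_(p in subgroup_pairs K) (chi p.1 p.2)%:R :> R by rewrite sumr_ge0.
(* The right-hand sum is nonnegative, hence the root of its own square; it remains to compare the
   radicands. *)
rewrite -[leRHS]ger0_norm // -sqrtr_sqr ler_wsqrtr //.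
rewrite (eq_bigl (fun q => (q.1 \in subgroup_pairs N) &&
                           (q.2 \in subgroup_pairs H))); last first.
  by case=> p1 p2; rewrite in_setX.
(* The summand separates, so the radicand is the sum for [N] times the sum for [H]; each is bounded
   by one factor of the square. *)
rewrite -(pair_big (mem (subgroup_pairs N)) (mem (subgroup_pairs H))
  (fun p1 p2 => (chi p1.1 p1.2)%:R * (chi p2.1 p2.2)%:R)) /= -big_distrlr /= expr2.
by apply: ler_pM => //; apply: sum_chi_subset => //; apply: normal_sub.
Qed.
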